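(* Let $n\in\mathbb{N}$ and let $\alpha\in\mathcal{D}_n$ be a Lie idempotent. Then $$\tilde\Xi^n\alpha=\begin{cases}2\alpha&\text{if }n\text{ is odd,}\\0&\text{otherwise.}\end{cases}$$ In particular, if $n$ is odd, then $\frac12\tilde\alpha=\frac12\alpha\tilde\Xi^n$ is a Lie idempotent in $\mathcal{P}_n$.
   Context: $K$ is a field of characteristic $0$. Permutations act on the right ($i\pi$ is the image of $i$) and products in $S_n$ are read from left to right (first $\pi$, then $\sigma$ in $\pi\sigma$). For $\pi\in S_n$: $\mathrm{Des}(\pi)=\{1\le i\le n-1\mid i\pi>(i+1)\pi\}$, $\mathrm{Peak}(\pi)=\{2\le i\le n-1\mid (i-1)\pi<i\pi>(i+1)\pi\}$. For $D\subseteq\{1,\ldots,n-1\}$, $\Delta^D=\sum_{\mathrm{Des}(\pi)=D}\pi$; $\mathcal{D}_n\subseteq KS_n$ is the span of the $\Delta^D$. $\mathcal{P}_n$ is the span of the elements $\Pi^P=\sum_{\mathrm{Peak}(\pi)=P}\pi$, $P\subseteq\{2,\ldots,n-1\}$. $\tilde\Xi^n:=2\Pi^\emptyset$, and $\tilde\alpha:=\alpha\tilde\Xi^n$. All products are in $KS_n$. Let $\omega_n=\sum_{k=0}^{n-1}(-1)^k\Delta^{\{1,\ldots,k\}}$ (the Dynkin operator). An idempotent $\alpha\in KS_n$ is called a Lie idempotent if $\alpha KS_n=\omega_nKS_n$. *)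

(* Defs.v *)
From HB Require Import structures.
From mathcomp Require Import all_boot all_order all_algebra all_fingroup.

Set Implicit Arguments.
Unset Strict Implicit.
Unset Printing Implicit Defensive.

Import GRing.Theory.
Local Open Scope ring_scope.

(* The group algebra K[gT]: an element is its coefficient function, and the
   product is the convolution for which [gbasis] is multiplicative (gbasisM). *)
Definition galg (K : fieldType) (gT : finGroupType) := {ffun gT -> K^o}.

Section GroupAlgebra.
Variables (K : fieldType) (gT : finGroupType).
Local Notation A := (galg K gT).

HB.instance Definition _ := Vector.on A.

Definition gbasis (x : gT) : A := [ffun y => (y == x)%:R].

Definition gmul (a b : A) : A :=
  [ffun x => \sum_(y : gT) (a y : K) * b (y^-1 * x)%g].

Fact gmulA : associative gmul.
Proof.
move=> a b c; apply/ffunP=> x; rewrite !ffunE.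
under eq_bigr => y _ do rewrite ffunE mulr_sumr.
under [RHS]eq_bigr => z _ do rewrite ffunE mulr_suml.
rewrite [RHS]exchange_big /=; apply: eq_bigr => y _.
rewrite [RHS](reindex_inj (mulgI y)) /=; apply: eq_bigr => z _.
by rewrite mulKg invMg mulrA mulgA.
Qed.

Fact gmul1l : left_id (gbasis 1%g) gmul.
Proof.
move=> a; apply/ffunP=> x; rewrite ffunE (bigD1 1%g) //= big1 => [|y y1].
  by rewrite ffunE eqxx mul1r invg1 mul1g addr0.
by rewrite ffunE (negPf y1) mul0r.
Qed.

Fact gmul1r : right_id (gbasis 1%g) gmul.
Proof.
move=> a; apply/ffunP=> x; rewrite ffunE (bigD1 x) //= big1 => [|y yx].
  by rewrite ffunE mulVg eqxx mulr1 addr0.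
by rewrite ffunE -eq_mulVg1 (negPf yx) mulr0.
Qed.

Fact gmulDl : left_distributive gmul +%R.
Proof.
move=> a b c; apply/ffunP=> x; rewrite !ffunE -big_split /=.
by apply: eq_bigr => y _; rewrite ffunE mulrDl.
Qed.

Fact gmulDr : right_distributive gmul +%R.
Proof.
move=> a b c; apply/ffunP=> x; rewrite !ffunE -big_split /=.
by apply: eq_bigr => y _; rewrite ffunE mulrDr.
Qed.

Fact gone_neq0 : gbasis 1%g != 0.
Proof.
by apply/eqP => /ffunP/(_ 1%g)/eqP; rewrite !ffunE eqxx oner_eq0.
Qed.

HB.instance Definition _ := GRing.Zmodule_isNzRing.Build A
  gmulA gmul1l gmul1r gmulDl gmulDr gone_neq0.

Fact gscaleAl (k : K) (a b : A) : k *: (a * b) = (k *: a) * b.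
Proof.
apply/ffunP=> x; rewrite !ffunE scaler_sumr.
by apply: eq_bigr => y _; rewrite ffunE -mulrA.
Qed.

HB.instance Definition _ := GRing.Lmodule_isLalgebra.Build K A gscaleAl.

Fact gscaleAr (k : K) (a b : A) : k *: (a * b) = a * (k *: b).
Proof.
apply/ffunP=> x; rewrite !ffunE scaler_sumr.
by apply: eq_bigr => y _; rewrite ffunE [LHS]mulrCA.
Qed.

HB.instance Definition _ := GRing.Lalgebra_isAlgebra.Build K A gscaleAr.

Lemma gbasisM (x y : gT) : gbasis (x * y)%g = gbasis x * gbasis y.
Proof.
apply/ffunP=> z; rewrite !ffunE (bigD1 x) //= big1 => [|t tx].
  by rewrite !ffunE eqxx mul1r addr0 (can2_eq (mulKVg x) (mulKg x)).
by rewrite ffunE (negPf tx) mul0r.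
Qed.

Lemma galg_sum (a : A) : a = \sum_(x : gT) a x *: gbasis x.
Proof.
apply/ffunP=> z; rewrite sum_ffunE (bigD1 z) //= big1 => [|x xz].
  by rewrite !ffunE eqxx [_ *: _]mulr1 addr0.
by rewrite !ffunE eq_sym (negPf xz) scaler0.
Qed.

End GroupAlgebra.

(* Permutations act on {0, ..., n-1} instead of {1, ..., n}, so the positions
   forming descent and peak sets are shifted down by one throughout.
   The product of 'S_n is already read from left to right (permM). *)

Definition Des n (s : 'S_n) : {set 'I_n} :=
  [set i : 'I_n | [exists j : 'I_n, (j == i.+1 :> nat) && (s j < s i)%N]].

Definition Peak n (s : 'S_n) : {set 'I_n} :=
  [set i : 'I_n | [exists h : 'I_n, exists j : 'I_n,
     [&& i == h.+1 :> nat, j == i.+1 :> nat, (s h < s i)%N & (s j < s i)%N]]].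

(* The 0-based counterparts of {1, ..., n-1} and {2, ..., n-1}. *)
Definition des_dom n : {set 'I_n} := [set i : 'I_n | (i.+1 < n)%N].
Definition peak_dom n : {set 'I_n} := [set i : 'I_n | (0 < i)%N & (i.+1 < n)%N].

Section PeakAlgebra.
Variables (K : fieldType) (n : nat).
Local Notation KS := (galg K 'S_n).

Definition Delta (D : {set 'I_n}) : KS := \sum_(s : 'S_n | Des s == D) gbasis K s.

Definition Pi (P : {set 'I_n}) : KS := \sum_(s : 'S_n | Peak s == P) gbasis K s.

Definition descent_space : {vspace KS} :=
  <<[seq Delta D | D in powerset (des_dom n)]>>%VS.

Definition peak_space : {vspace KS} :=
  <<[seq Pi P | P in powerset (peak_dom n)]>>%VS.

Definition Xi_tilde : KS := 2%:R *: Pi set0.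

Definition tilde (a : KS) : KS := a * Xi_tilde.

(* [set i | i < k] is {1, ..., k} shifted down by one. *)
Definition dynkin : KS :=
  \sum_(k < n) (-1) ^+ k *: Delta [set i : 'I_n | (i < k)%N].

Definition Lie_idempotent (a : KS) : Prop :=
  a * a = a /\
  (forall x : KS, (exists y, x = a * y) <-> (exists y, x = dynkin * y)).

End PeakAlgebra.

Arguments Xi_tilde : clear implicits.
Arguments dynkin : clear implicits.
Arguments descent_space : clear implicits.
Arguments peak_space : clear implicits.

(* Main.v *)
Require Import Defs.
From mathcomp Require Import all_boot all_order all_algebra all_fingroup.
From mathcomp Require Import zify.

Set Implicit Arguments.
Unset Strict Implicit.
Unset Printing Implicit Defensive.

Import GRing.Theory.
Local Open Scope ring_scope.

(* Write rho_A^-1 for the word listing A in decreasing order and then its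
   complement in increasing order. Summing over all A yields Xi_tilde, since a
   peakless permutation arises from exactly two sets A (its bottom letter may
   lie on either side). The same words, restricted to A not containing the least
   letter and signed by |A|, sum to the Dynkin operator.

   Left multiplication by Xi_tilde extracts a subset C of the letters of a word,
   reverses it and puts it in front. On the Dynkin operator, moving the least
   letter of C or of its complement across the valley is a sign-reversing
   involution that cancels every term except C empty, which gives back the
   Dynkin operator, and C full, which gives its reversal, that is, (-1)^(n-1)
   times it. As alpha = dynkin * y for some y, this is the
   first claim, and it makes half of alpha * Xi_tilde a Lie idempotent.

   For the peak space: the sum of all permutations with descents in D, times
   Xi_tilde, has at s the coefficient counting the A with
   Des (s * rho_A) included in D. It is 0 if s has a peak i with i - 1 and i both
   outside D, and otherwise a power of 2 depending only on D. *)

(** * Counting, and permutations as relative orders *)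

Lemma card_set_interval (T : finType) (X Y : {set T}) : X \subset Y ->
  #|[set S : {set T} | X \subset S & S \subset Y]| = (2 ^ (#|Y| - #|X|))%N.
Proof.
move=> XY; have -> : (#|Y| - #|X|)%N = #|Y :\: X| by rewrite cardsD (setIidPr XY).
rewrite -card_powerset -[RHS](@card_in_imset _ _ (fun S => X :|: S)); last first.
  have XK (S : {set T}) : S \in powerset (Y :\: X) -> (X :|: S) :\: X = S.
    rewrite inE subsetD => /andP[_ /setDidPl SX].
    by rewrite setDUl setDv set0U SX.
  by move=> S S' /XK {2}<- /XK {2}<- ->.
apply: eq_card => S; rewrite !inE; apply/andP/imsetP => [[XS SY] | [S']].
  exists (S :\: X); first by rewrite inE setSD.
  by rewrite -{1}(setIidPr XS) setID.
rewrite inE subsetD => /andP[S'Y _] ->.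
by rewrite subsetUl subUset XY.
Qed.

Lemma card_ord_lt n k : (k <= n)%N -> #|[set i : 'I_n | (i < k)%N]| = k.
Proof.
move=> le_kn; have wI : injective (widen_ord le_kn).
  by move=> i j /(congr1 val) /= /val_inj.
rewrite -[RHS]card_ord -cardsT -(card_imset _ wI).
apply: eq_card => i; rewrite !inE; apply/idP/imsetP => [ik | [j _ ->]] /=.
  by exists (Ordinal ik) => //; apply: val_inj.
exact: ltn_ord.
Qed.

Lemma card_perm_lt n (p : 'S_n) u : #|[set v | (p v < p u)%N]| = p u.
Proof.
rewrite -[RHS](card_ord_lt (ltnW (ltn_ord (p u)))).
rewrite -(card_imset _ (@perm_inj _ p)); apply: eq_card => i.
rewrite inE; apply/imsetP/idP => [[v] | lt_i]; first by rewrite inE => ? ->.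
by exists (p^-1 i)%g; rewrite ?inE permKV.
Qed.

(** The value [p u] counts the letters with smaller value, so the relative order of the values
    determines [p]. *)
Lemma eq_perm_lt n (p q : 'S_n) :
  (forall u v, u != v -> (p u < p v)%N = (q u < q v)%N) -> p = q.
Proof.
move=> pq; apply/permP => u; apply: val_inj => /=.
rewrite -card_perm_lt -[RHS]card_perm_lt; apply: eq_card => v; rewrite !inE.
by have [->|/pq] := eqVneq v u; rewrite ?ltnn.
Qed.

Section Standardization.
Variables (n : nat) (f : 'I_n -> nat).
Hypothesis f_inj : injective f.

Let rank u := #|[set v | (f v < f u)%N]|.

Fact rank_lt u : (rank u < n)%N.
Proof.
rewrite -[n in (_ < n)%N]card_ord -cardsT; apply: proper_card.
by apply/properP; split; [exact: subsetT | exists u; rewrite !inE ?ltnn].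
Qed.

Fact rank_mono u v : (rank u < rank v)%N = (f u < f v)%N.
Proof.
apply/idP/idP => [|lt_uv].
  apply: contraLR; rewrite -!leqNgt => le_vu; apply: subset_leq_card.
  by apply/subsetP => w; rewrite !inE => /leq_trans; apply.
apply: proper_card; apply/properP; split.
  by apply/subsetP => w; rewrite !inE => /ltn_trans; apply.
by exists u; rewrite !inE ?ltnn.
Qed.

Fact rank_inj : injective (fun u => Ordinal (rank_lt u)).
Proof.
move=> u v /(congr1 val) /= uv; apply: f_inj.
by case: (ltngtP (f u) (f v)) => //; rewrite -rank_mono uv ltnn.
Qed.

Definition std : 'S_n := perm rank_inj.

Lemma val_std u : std u = #|[set v | (f v < f u)%N]| :> nat.
Proof. by rewrite permE. Qed.

Lemma std_lt u v : (std u < std v)%N = (f u < f v)%N.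
Proof. by rewrite !permE rank_mono. Qed.

End Standardization.

(** * Valley permutations and descents *)

Section Valley.
Variable n : nat.
Implicit Types (A B C : {set 'I_n}) (u v : 'I_n).

(* Sorting by this key lists A in decreasing order, then the complement of A in
   increasing order; whether 0 is in A is irrelevant. *)
Definition key A u : nat := if u \in A then (n - u)%N else (n + u)%N.

Lemma key_inj A : injective (key A).
Proof.
move=> u v; rewrite /key => uv; apply: val_inj => /=.
have := ltn_ord u; have := ltn_ord v.
by case: (u \in A) (v \in A) uv => [] []; lia.
Qed.

Definition rho A : 'S_n := std (@key_inj A).

Lemma rho_lt A u v : (rho A u < rho A v)%N = (key A u < key A v)%N.
Proof. exact: std_lt. Qed.

Lemma key_lt A u v : u != v -> (key A u < key A v)%N =
  (if u \in A then (v \notin A) || (v < u)%N else (v \notin A) && (u < v)%N).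
Proof.
rewrite -val_eqE /= /key; have := ltn_ord u; have := ltn_ord v.
by case: (u \in A); case: (v \in A) => /=; lia.
Qed.

Lemma mem_rho A u : (u \in A) = (rho A u < #|A|)%N.
Proof.
rewrite val_std; apply/idP/idP => [uA | ].
  apply: proper_card; apply/properP; split; last by exists u; rewrite ?inE ?ltnn.
  by apply/subsetP => v; rewrite inE /key uA; case: (v \in A) => //; lia.
apply: contraLR => uA; rewrite -leqNgt; apply: subset_leq_card.
apply/subsetP => v vA; rewrite inE key_lt ?vA ?uA //.
by apply: contraTneq vA => ->.
Qed.

End Valley.

Lemma Des_lt n (s : 'S_n) (i j : 'I_n) : j = i.+1 :> nat ->
  (i \in Des s) = (s j < s i)%N.
Proof.
move=> ji; rewrite inE; apply/existsP/idP => [[k /andP[/eqP ki]] | lt_ji].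
  by have -> : k = j by apply: val_inj; rewrite /= ki ji.
by exists j; rewrite ji eqxx.
Qed.

Lemma Des_dom n (s : 'S_n) : Des s \subset des_dom n.
Proof.
apply/subsetP => i; rewrite !inE => /existsP[j /andP[/eqP <- _]].
exact: ltn_ord.
Qed.

Lemma des_domP n (i : 'I_n) :
  reflect (exists j : 'I_n, j = i.+1 :> nat) (i \in des_dom n).
Proof.
rewrite inE; apply: (iffP idP) => [lt_i|[j <-]]; last exact: ltn_ord.
by exists (Ordinal lt_i).
Qed.

Lemma notin_Des n (s : 'S_n) (i j : 'I_n) : j = i.+1 :> nat ->
  (i \notin Des s) = (s i < s j)%N.
Proof.
move=> ji; rewrite (Des_lt s ji) -leqNgt leq_eqVlt.
case: eqVneq => //= /val_inj/perm_inj eq_ij.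
by move: ji; rewrite eq_ij => /n_Sn.
Qed.

Lemma Des_eq0 n (s : 'S_n) : (Des s == set0) = (s == 1%g).
Proof.
apply/eqP/eqP => [des0 | ->]; last first.
  apply/setP => i; rewrite in_set0; apply/negbTE/negP => /[dup].
  move=> /(subsetP (Des_dom _))/des_domP[j ji].
  by rewrite (Des_lt _ ji) !perm1 ji ltnNge leqnSn.
have incr k : forall i j : 'I_n, j = (i + k.+1)%N :> nat -> (s i < s j)%N.
  elim: k => [|k IHk] i j ji.
    by rewrite -(notin_Des s (j := j)) ?des0 ?inE // ji addn1.
  have lt_i : (i + k.+1 < n)%N by have := ltn_ord j; lia.
  apply: (ltn_trans (IHk i (Ordinal lt_i) erefl)).
  by rewrite -(notin_Des s (j := j)) ?des0 ?inE // ji addnS.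
apply: eq_perm_lt => u v uv; rewrite !perm1.
have [lt_uv|lt_vu|/val_inj eq_uv] := ltngtP u v; last by rewrite eq_uv eqxx in uv.
  by apply: (incr (v - u.+1)%N); lia.
by apply/negbTE; rewrite -leqNgt ltnW // (incr (u - v.+1)%N) //; lia.
Qed.

(** * Descents of products with valley permutations *)

Section ValleyCounting.
Variable n : nat.
Implicit Types (A D S : {set 'I_n}) (s : 'S_n).

Definition shift_set S : {set 'I_n} :=
  [set j : 'I_n | [exists i in S, j == i.+1 :> nat]].

Lemma shift_setP S (j : 'I_n) :
  reflect (exists2 i, i \in S & j = i.+1 :> nat) (j \in shift_set S).
Proof.
by rewrite inE; apply: (iffP exists_inP) => -[i iS /eqP ji]; exists i.
Qed.

Lemma card_shift_set S : S \subset des_dom n -> #|shift_set S| = #|S|.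
Proof.
move=> /subsetP Sdom.
have succ_lt (i : 'I_n) : i \in S -> (i.+1 < n)%N.
  by move=> /Sdom/des_domP[j <-].
pose succ (i : 'I_n) : 'I_n := if insub i.+1 is Some j then j else i.
have succE i : i \in S -> succ i = i.+1 :> nat.
  by move=> /succ_lt lt_i; rewrite /succ insubT.
rewrite -[RHS](@card_in_imset _ _ succ); last first.
  move=> i j iS jS eq_ij; have := succE i iS.
  by rewrite eq_ij succE // => -[/val_inj].
apply: eq_card => j; apply/shift_setP/imsetP => -[i iS ji]; exists i => //.
  by apply: val_inj; rewrite /= succE.
by rewrite ji succE.
Qed.

(** Positions at which a peak of [s] forces a descent of [s * rho A] outside [D], whatever [A]
    is. *)
Definition peak_obstr D : {set 'I_n} := shift_set (~: D) :\: D.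

(* Each position i outside D imposes exactly one condition on S = s^-1 (A):
   i \in S if i is a descent of s, and i + 1 \notin S otherwise. Two conditions
   clash precisely at a peak. *)
Lemma Des_mul_rho D s S :
  (Des (s * rho (s @: S))%g \subset D) =
  (Des s :\: D \subset S) &&
  (S \subset ~: shift_set (des_dom n :\: (Des s :|: D))).
Proof.
have DesE (i j : 'I_n) : j = i.+1 :> nat -> (i \in Des (s * rho (s @: S))%g) =
    (if i \in Des s then i \notin S else j \in S).
  move=> ji; have ij : s j != s i.
    rewrite (inj_eq perm_inj) -val_eqE /= ji; apply/eqP => /esym; exact: n_Sn.
  rewrite (Des_lt _ ji) !permM rho_lt key_lt // !mem_imset; try exact: perm_inj.
  rewrite (Des_lt s ji); have := notin_Des s ji; rewrite (Des_lt s ji).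
  by move=> <-; case: (_ < _)%N; case: (i \in S); case: (j \in S).
apply/subsetP/andP => [sD | [/subsetP sS /subsetP Ss] i].
  split; apply/subsetP => j.
    rewrite in_setD => /andP[jD jdes]; move: (jdes).
    move/(subsetP (Des_dom _))/des_domP => [k kj].
    by apply: contraR jD => jS; apply: sD; rewrite (DesE _ _ kj) jdes.
  rewrite in_setC; apply: contraL => /shift_setP[i].
  rewrite in_setD in_setU negb_or => /andP[/andP[ides iD] _] ji.
  by apply: contraNN iD => jS; apply: sD; rewrite (DesE _ _ ji) (negPf ides).
move=> /[dup] /(subsetP (Des_dom _)) idom; case/des_domP: (idom) => j ji.
rewrite (DesE _ _ ji); apply: contraTT => iD; case: ifP => ides.
  by rewrite negbK; apply: sS; rewrite inE iD.
apply/negP => /Ss; rewrite in_setC => /shift_setP[]; exists i => //.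
by rewrite in_setD in_setU negb_or ides iD.
Qed.

Lemma Peak_Des s (i j : 'I_n) : j = i.+1 :> nat ->
  (j \in Peak s) = (i \notin Des s) && (j \in Des s).
Proof.
move=> ji; rewrite (notin_Des _ ji) [j \in Peak s]inE.
apply/existsP/andP => [[h /existsP[k /and4P[/eqP jh /eqP kj]]] | [lt_ij]].
  have -> : h = i by apply: val_inj; apply: succn_inj; rewrite /= -jh ji.
  by rewrite (Des_lt _ kj).
rewrite inE => /existsP[k /andP[/eqP kj lt_kj]]; exists i; apply/existsP.
by exists k; rewrite ji kj ji !eqxx lt_ij.
Qed.

(** Substituting [A = s @: S] turns the condition into [S] containing [X] and avoiding [Z]. The
    count sees [s] only through [Peak s], as the peak space requires. *)
Lemma card_rho_Des D s :
  #|[set A | Des (s * rho A)%g \subset D]| =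
  (if [disjoint Peak s & peak_obstr D]
   then 2 ^ (n - #|des_dom n :\: D|) else 0)%N.
Proof.
pose X := Des s :\: D; pose Z := shift_set (des_dom n :\: (Des s :|: D)).
have sI : injective (fun S : {set 'I_n} => s @: S) by apply: imset_inj; exact: perm_inj.
have -> : #|[set A | Des (s * rho A)%g \subset D]| =
          #|[set S : {set 'I_n} | (X \subset S) && (S \subset ~: Z)]|.
  rewrite -(card_preimset _ sI); apply: eq_card => S.
  by rewrite !inE Des_mul_rho.
have XZ : X :&: Z = Peak s :&: peak_obstr D.
  apply/setP => j; rewrite !in_setI !in_setD.
  apply/andP/and3P => [[/andP[jD jdes] /shift_setP[i]] | ].
    rewrite in_setD in_setU negb_or => /andP[/andP[ides iD] _] ji.
    rewrite (Peak_Des _ ji) ides jdes jD; split=> //.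
    by apply/shift_setP; exists i; rewrite ?in_setC.
  move=> [jP jD /shift_setP[i]]; rewrite in_setC => iD ji.
  move: jP; rewrite (Peak_Des _ ji) => /andP[ides jdes]; rewrite jD jdes.
  split=> //; apply/shift_setP; exists i => //.
  rewrite in_setD in_setU negb_or ides iD /=.
  by apply/des_domP; exists j.
rewrite -setI_eq0 -XZ setI_eq0 disjoints_subset.
case: ifP => [/card_set_interval -> | XZ'].
  (* Each position outside [D] is either a descent, counted in [X], or not, and then its successor
     is counted in [Z]. *)
  congr (2 ^ _)%N; rewrite -(cardsID (Des s) (des_dom n :\: D)).
  have -> : (des_dom n :\: D) :&: Des s = X.
    by rewrite setIDAC (setIidPr (Des_dom s)).
  have := cardsC Z; rewrite card_ord card_shift_set ?subsetDl //.
  by rewrite setDDl setUC; lia.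
apply/eqP; rewrite cards_eq0; apply/eqP/setP => S; rewrite !inE.
by apply/negP => /andP[/subset_trans XS /XS]; rewrite XZ'.
Qed.

End ValleyCounting.

(** * Toggling a letter; shuffles of valley words *)

Definition toggle n (m : 'I_n) (B : {set 'I_n}) : {set 'I_n} :=
  [set u | (u \in B) (+) (u == m)].

Lemma in_toggle n (m : 'I_n) B u : (u \in toggle m B) = (u \in B) (+) (u == m).
Proof. by rewrite inE. Qed.

Lemma toggleK n (m : 'I_n) : involutive (toggle m).
Proof. by move=> B; apply/setP => u; rewrite !in_toggle addbK. Qed.

Lemma sign_toggle (R : pzRingType) n (m : 'I_n) B :
  (-1) ^+ #|toggle m B| = - (-1) ^+ #|B| :> R.
Proof.
wlog mB : B / m \in B => [wl|].
  have [/wl //|mB] := boolP (m \in B).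
  have := wl (toggle m B); rewrite toggleK in_toggle eqxx addbT mB.
  by move=> /(_ isT) ->; rewrite opprK.
have -> : toggle m B = B :\ m.
  apply/setP => u; rewrite in_toggle !inE.
  by have [->|_] := eqVneq; rewrite ?mB ?addbF.
by rewrite [#|B|](cardsD1 m) mB exprS mulN1r opprK.
Qed.

Section Shuffle.
Variable n : nat.
Implicit Types (B C : {set 'I_n}) (u v m : 'I_n).

(* The inverse of [shuffle B C] is the word listing the letters of C, then those
   of its complement, where the word (rho B)^-1 is followed in the second block
   and its reversal in the first one. *)
Definition shuffle B C : 'S_n := (rho B * rho (rho B @: C))%g.

Lemma shuffle_lt B C u v : u != v ->
  (shuffle B C u < shuffle B C v)%N =
  (if u \in C then (v \notin C) || (key B v < key B u)%N
   else (v \notin C) && (key B u < key B v)%N).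
Proof.
move=> uv; rewrite !permM rho_lt key_lt ?(inj_eq perm_inj) //.
by rewrite !rho_lt !mem_imset //; exact: perm_inj.
Qed.

(* A minimal letter sits at the bottom of the valley, whichever side it is on. *)
Lemma key_lt_toggle B m u v : u != v -> (m <= u)%N -> (m <= v)%N ->
  (key (toggle m B) u < key (toggle m B) v)%N = (key B u < key B v)%N.
Proof.
move=> uv mu mv; rewrite !key_lt // !in_toggle; move: uv mu mv.
rewrite -!val_eqE /=.
case: (u \in B); case: (v \in B) => /=; case: (eqVneq (u : nat) m) => /= ?;
  case: (eqVneq (v : nat) m) => /= ?; lia.
Qed.

Lemma key_toggle B m u : u != m -> key (toggle m B) u = key B u.
Proof. by move=> um; rewrite /key in_toggle (negPf um) addbF. Qed.

(** Letters in different blocks compare independently of [B]. Within a block only comparisons with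
    [m] could change, and [m], minimal in its block, stays at the bottom of the valley. *)
Lemma shuffle_toggle B C m :
    (forall u, (u \in C) = (m \in C) -> (m <= u)%N) ->
  shuffle (toggle m B) C = shuffle B C.
Proof.
move=> m_min; apply: eq_perm_lt => u v uv; rewrite !shuffle_lt //.
have same x y : x != y -> (x \in C) = (y \in C) ->
    (key (toggle m B) x < key (toggle m B) y)%N = (key B x < key B y)%N.
  move=> xy xyC; have [xm|xm] := boolP ((x \in C) == (m \in C)).
    by rewrite key_lt_toggle // m_min // -?xyC (eqP xm).
  rewrite !key_toggle //; last by apply: contraNneq xm => <-.
  by apply: contraNneq xm => <-; rewrite xyC.
case uC: (u \in C); case vC: (v \in C) => //=; apply: same;
  by rewrite ?uC ?vC // eq_sym.
Qed.

Lemma rho_set0 : rho set0 = 1%g :> 'S_n.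
Proof.
by apply: eq_perm_lt => u v uv; rewrite rho_lt key_lt // !inE !perm1.
Qed.

Lemma shuffle_set0 B : shuffle B set0 = rho B.
Proof. by rewrite /shuffle imset0 rho_set0 mulg1. Qed.

End Shuffle.

(** The reversed word lists the complement of [B] downwards to [ord0], then [B] upwards. Moving
    [ord0] to the second block gives an index set avoiding [ord0] again. *)
Lemma shuffle_setT n (B : {set 'I_n.+1}) : ord0 \notin B ->
  shuffle B setT = rho (~: (ord0 |: B)).
Proof.
move=> B0; apply: eq_perm_lt => u v uv.
have vu : v != u by rewrite eq_sym.
rewrite shuffle_lt // rho_lt !in_setT /= !key_lt // !in_setC !in_setU1 !negbK.
have [->|] := eqVneq u ord0; have [->|] := eqVneq v ord0;
  rewrite -?val_eqE ?(negPf B0) /=; case: (u \in B); case: (v \in B) => /=; lia.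
Qed.

(** * From the descent space into the peak space *)

Section GroupAlgebra.
Variables (K : fieldType) (n : nat).
Local Notation KS := (galg K 'S_n).

Definition valley_sum : KS := \sum_(A : {set 'I_n}) gbasis K (rho A)^-1%g.

Definition Delta_le (D : {set 'I_n}) : KS :=
  \sum_(s : 'S_n | Des s \subset D) gbasis K s.

Lemma peak_space_sum (c : {set 'I_n} -> K) :
  \sum_(s : 'S_n) c (Peak s) *: gbasis K s \in peak_space K n.
Proof.
rewrite (partition_big (@Peak n) xpredT) //=; apply: rpred_sum => P _.
have -> : \sum_(s | Peak s == P) c (Peak s) *: gbasis K s = c P *: Pi K P.
  by rewrite scaler_sumr; apply: eq_bigr => s /eqP ->.
have [Pdom|Pdom] := boolP (P \subset peak_dom n).
  apply: rpredZ; apply: memv_span; apply: map_f.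
  by rewrite mem_enum inE.
rewrite /Pi big_pred0 ?scaler0 ?rpred0 // => s.
apply: contraNF Pdom => /eqP <-; apply/subsetP => i; rewrite !inE.
move=> /existsP[h /existsP[j /and4P[/eqP -> /eqP <- _ _]]].
by rewrite ltn_ord.
Qed.

(** A pair [(t, A)] contributes to [s] exactly when [t = s * rho A]. *)
Lemma Delta_le_valley D : Delta_le D * valley_sum =
  \sum_(s : 'S_n) #|[set A | Des (s * rho A)%g \subset D]|%:R *: gbasis K s.
Proof.
rewrite mulr_sumr.
under eq_bigr => A _.
  rewrite mulr_suml; under eq_bigr => s _ do rewrite -gbasisM.
  rewrite (reindex_inj (mulIg (rho A))) /=.
  under eq_bigr => s _ do rewrite mulgK.
  over.
rewrite (exchange_big_dep xpredT) //=; apply: eq_bigr => s _.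
by rewrite sumr_const scaler_nat -cardsE.
Qed.

Lemma Delta_le_valley_peak D : Delta_le D * valley_sum \in peak_space K n.
Proof.
rewrite Delta_le_valley.
under eq_bigr => s _ do rewrite card_rho_Des.
exact: (peak_space_sum (fun P => (if [disjoint P & _] then _ else _)%:R)).
Qed.

Lemma Delta_valley_peak D : Delta K D * valley_sum \in peak_space K n.
Proof.
have [k] := ubnP #|D|; elim: k D => // k IHk D leDk.
(* Triangularity: the subtracted terms have smaller descent sets, so induction on [#|D|] applies to
   them. *)
have -> : Delta K D = Delta_le D - \sum_(E : {set 'I_n} | E \proper D) Delta K E.
  apply/eqP; rewrite -subr_eq opprK; apply/eqP.
  rewrite /Delta_le (partition_big (@Des n) (fun E => E \subset D)) //=.
  rewrite [RHS](bigD1 D) //=; congr (_ + _).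
    by apply: eq_bigl => s; case: eqP => [->|]; rewrite ?subxx ?andbF.
  apply: eq_big => [E|E ED]; first by rewrite properEneq andbC.
  apply: eq_bigl => s; case: eqP => [->|]; rewrite ?andbF //.
  by rewrite (proper_sub ED).
rewrite mulrBl rpredB ?Delta_le_valley_peak // mulr_suml rpred_sum // => E ED.
exact/IHk/(leq_trans (proper_card ED)).
Qed.

Lemma descent_valley_peak a :
  a \in descent_space K n -> a * valley_sum \in peak_space K n.
Proof.
move=> aD; rewrite (coord_span (X := in_tuple _) aD) mulr_suml.
apply: rpred_sum => i _; rewrite -scalerAl; apply: rpredZ.
have /imageP[D _ ->] := mem_nth 0 (ltn_ord i).
exact: Delta_valley_peak.
Qed.

End GroupAlgebra.

(** * The Dynkin operator as an eigenvector of the valley sum *)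

Section Dynkin.
Variables (K : fieldType) (n : nat).
Implicit Types (B C : {set 'I_n.+1}) (s : 'S_n.+1).

(** The case [D = set0] of the count: [n] conditions on the membership of [n.+1] letters leave one
    free choice, whence the factor 2. *)
Lemma Xi_tilde_valley : Xi_tilde K n.+1 = valley_sum K n.+1.
Proof.
rewrite -[RHS]mul1r.
have -> : 1 = Delta_le K (set0 : {set 'I_n.+1}).
  rewrite /Delta_le (eq_bigl (pred1 1%g)) ?big_pred1_eq // => s.
  by rewrite subset0 Des_eq0.
rewrite Delta_le_valley /Xi_tilde /Pi scaler_sumr big_mkcond /=.
apply: eq_bigr => s _; rewrite card_rho_Des setD0.
have -> : #|des_dom n.+1| = n.
  exact: (card_ord_lt (leqnSn n)).
have -> : [disjoint Peak s & peak_obstr set0] = (Peak s == set0).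
  rewrite -setI_eq0 /peak_obstr setD0 (setIidPl _) //; apply/subsetP => j.
  rewrite inE => /existsP[i /existsP[_ /andP[/eqP ji _]]].
  by apply/shift_setP; exists i; rewrite ?inE.
by case: ifP; rewrite ?scale0r // subSnn.
Qed.

Definition initial k : {set 'I_n.+1} := [set i : 'I_n.+1 | (i < k)%N].

Lemma card_initial k : (k <= n.+1)%N -> #|initial k| = k.
Proof. exact: card_ord_lt. Qed.

(** One half of the bijection between permutations with descent set [initial k] and [k]-element sets
    avoiding [ord0]. By [Des_mul_rho] with [D = set0], the product of [s] with this [rho] has no
    descent. *)
Lemma rho_initial k s : Des s = initial k -> rho (s @: initial k) = s^-1%g.
Proof.
move=> sk; apply: (mulgI s); rewrite mulgV; apply/eqP.
rewrite -Des_eq0 -subset0 Des_mul_rho sk setD0 subxx /= setU0.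
apply/subsetP => j; rewrite inE in_setC => jk; apply/shift_setP => -[i].
by rewrite !inE -leqNgt => /andP[ki _] ji; lia.
Qed.

Lemma min_notin_initial k s : Des s = initial k -> ord0 \notin s @: initial k.
Proof.
move=> sk; apply/imsetP => -[i]; rewrite -sk.
by rewrite inE => /existsP[j /andP[_ lt_ji]] s0; rewrite -s0 in lt_ji.
Qed.

Lemma rhoV_imset B : (rho B)^-1%g @: initial #|B| = B.
Proof.
apply/setP => u; rewrite (mem_rho B); apply/imsetP/idP => [[i]|uB].
  by rewrite inE => iB ->; rewrite permKV.
by exists (rho B u); rewrite ?inE // permK.
Qed.

Lemma card_notin B (u : 'I_n.+1) : u \notin B -> (#|B| <= n)%N.
Proof. by move=> uB; have := max_card (u |: B); rewrite card_ord cardsU1 uB. Qed.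

Lemma Des_rhoV B : ord0 \notin B -> Des (rho B)^-1%g = initial #|B|.
Proof.
move=> B0; set s := (rho B)^-1%g.
have sB i : (s i \in B) = (i < #|B|)%N by rewrite mem_rho permKV.
have B_le_n := card_notin B0.
apply/setP => i; rewrite [RHS]inE -sB.
have [/des_domP[j ji] | idom] := boolP (i \in des_dom n.+1); last first.
  rewrite (negPf (contra (subsetP (Des_dom s) i) idom)) sB.
  by move: idom; rewrite inE; lia.
have sij : s i != s j by rewrite (inj_eq perm_inj) -val_eqE /= ji; lia.
have key_ij : (key B (s i) < key B (s j))%N by rewrite -rho_lt !permKV ji.
rewrite (Des_lt _ ji); move: (key_ij); rewrite key_lt //; case: ifP => siB.
  case/orP => // sjB; have [sj0|sj0] := eqVneq (s j) ord0.
    by move: sij; rewrite sj0 -val_eqE lt0n.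
  (* Otherwise [ord0], also outside [B], would precede [s j], although [j] is the first position
     past the block of [B]. *)
  have : (key B ord0 < key B (s j))%N.
    by rewrite key_lt 1?eq_sym // (negPf B0) sjB lt0n.
  rewrite -rho_lt permKV; move: B0 siB; rewrite (mem_rho B ord0) sB.
  by rewrite ji; lia.
by case/andP => _ /ltnW; rewrite leqNgt => /negbTE.
Qed.

Lemma dynkin_valley : dynkin K n.+1 =
  \sum_(B : {set 'I_n.+1} | ord0 \notin B)
    (-1) ^+ #|B| *: gbasis K (rho B)^-1%g.
Proof.
(* A set avoiding [ord0] has at most [n] elements, so [inord] never falls back on its default. *)
rewrite [RHS](partition_big (fun B => inord #|B| : 'I_n.+1) xpredT) //=.
apply: eq_bigr => k _; rewrite /Delta -/(initial k).
rewrite scaler_sumr.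
rewrite (reindex_onto (fun B => (rho B)^-1%g) (fun s => s @: initial k)) /=; last first.
  by move=> s /eqP/rho_initial ->; rewrite invgK.
apply: eq_big => [B | B /andP[/eqP desB /eqP imB]].
  apply/andP/andP => [[/eqP desB /eqP imB] | [B0 /eqP Bk]].
    rewrite -imB (min_notin_initial desB); split=> //; apply/eqP.
    rewrite card_imset ?card_initial ?inord_val //; last exact: perm_inj.
    exact: ltnW.
  by rewrite -Bk inordK ?ltnS ?(card_notin B0) // rhoV_imset Des_rhoV.
rewrite -[X in (-1) ^+ #|pred_of_set X|]imB card_imset ?card_initial ?(ltnW (ltn_ord k)) //.
exact: perm_inj.
Qed.

(** Take the least letter on the side of [C] not holding [ord0]. As it differs from [ord0], toggling
    it preserves [ord0 \notin B]. *)
Lemma toggle_separator C : C != set0 -> C != setT ->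
  exists2 m : 'I_n.+1, m != ord0 &
    forall u, (u \in C) = (m \in C) -> (m <= u)%N.
Proof.
move=> C0 CT.
have [u0 u0P] : exists u, (u \in C) != (ord0 \in C).
  have [C1|C1] := boolP (ord0 \in C).
    by move: CT; rewrite -properT => /properP[_ [u _ uC]]; exists u; rewrite (negPf uC).
  by have /set0Pn[u uC] := C0; exists u; rewrite uC.
case: (@arg_minnP _ u0 [pred u | (u \in C) != (ord0 \in C)] val u0P) => /= m mP m_min.
exists m => [|u um]; first by apply: contraNneq mP => ->.
by apply: m_min; rewrite um.
Qed.

Lemma sum_sign_shuffle C : C != set0 -> C != setT ->
  \sum_(B : {set 'I_n.+1} | ord0 \notin B)
    (-1) ^+ #|B| *: gbasis K (shuffle B C)^-1%g = 0.
Proof.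
move=> C0 CT; have [m m0 m_min] := toggle_separator C0 CT.
rewrite (bigID (fun B => m \in B)) /= [X in _ + X](reindex_inj (inv_inj (toggleK m))) /=.
rewrite [X in _ + X](eq_bigl (fun B => (ord0 \notin B) && (m \in B))); last first.
  by move=> B; rewrite !in_toggle eqxx addbT negbK eq_sym (negPf m0) addbF.
rewrite -big_split /= big1 // => B _.
by rewrite shuffle_toggle // sign_toggle scaleNr subrr.
Qed.

Lemma valley_dynkin :
  valley_sum K n.+1 * dynkin K n.+1 = (1 + (-1) ^+ n) *: dynkin K n.+1.
Proof.
rewrite dynkin_valley mulr_sumr.
under eq_bigr => B _.
  rewrite mulr_suml.
  (* Writing [A = rho B @: C] makes [C] a set of letters, so that the sum over [B] can be taken for
     fixed [C]. *)
  rewrite (reindex_inj (imset_inj (@perm_inj _ (rho B)))) /=.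
  under eq_bigr => C _ do rewrite -scalerAr -gbasisM -invMg -/(shuffle B C).
  over.
rewrite exchange_big /= (bigD1 set0) //= [X in _ + X](bigD1 setT) /=; last first.
  by apply/eqP => /setP/(_ ord0); rewrite !inE.
rewrite [X in _ + (_ + X)]big1 ?addr0 => [|C /andP[C0 CT]]; last first.
  exact: sum_sign_shuffle.
rewrite scalerDl scale1r; congr (_ + _).
  by apply: eq_bigr => B _; rewrite shuffle_set0.
(* Reversal acts on [B] by complementation among the nonzero letters; [#|B|] becomes [n - #|B|], the
   source of [(-1) ^+ n]. *)
pose f B := ~: (ord0 |: B).
have fK B : ord0 \notin B -> f (f B) = B.
  move=> B0; apply/setP => u; rewrite !inE negb_or.
  by have [->|] := eqVneq; rewrite ?(negPf B0) ?negbK.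
have f0 B : ord0 \notin f B by rewrite !inE eqxx.
have cardf B : ord0 \notin B -> #|f B| = (n - #|B|)%N.
  by move=> B0; rewrite cardsCs setCK card_ord cardsU1 B0 subSS.
rewrite (reindex_onto f f) => [|B B0]; last exact: fK.
rewrite scaler_sumr; apply: eq_big => [B | B /andP[_ /eqP fB]].
  rewrite f0; apply/eqP/idP => [<- //|]; exact: fK.
have B0 : ord0 \notin B by rewrite -fB.
rewrite shuffle_setT // -/(f _) fB scalerA cardf //.
have -> : (-1) ^+ n = (-1) ^+ (n - #|B|) * (-1) ^+ #|B| :> K.
  by rewrite -exprD subnK ?(card_notin B0).
by rewrite -mulrA -expr2 sqrr_sign mulr1.
Qed.

End Dynkin.

Theorem proposition7p1 (K : fieldType) (charK : [pchar K] =i pred0) (n : nat)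
    (alpha : galg K 'S_n) (alphaD : alpha \in descent_space K n)
    (alphaLie : Lie_idempotent alpha) :
  Xi_tilde K n * alpha = (if odd n then 2%:R *: alpha else 0) /\
  (odd n -> Lie_idempotent (2%:R^-1 *: tilde alpha) /\
            2%:R^-1 *: tilde alpha \in peak_space K n).
Proof.
case: alphaLie => alpha_idem alpha_dyn.
have [y alphaE] : exists y, alpha = dynkin K n * y.
  by apply/alpha_dyn; exists 1; rewrite mulr1.
(* For [n = 0] the sum [dynkin] is empty, so [alpha] is 0. *)
case: n => [|n] in alpha alphaD alpha_idem alpha_dyn y alphaE *.
  by rewrite alphaE /dynkin big_ord0 mul0r mulr0.
have Xi_alpha : Xi_tilde K n.+1 * alpha = (if odd n.+1 then 2%:R *: alpha else 0).
  rewrite Xi_tilde_valley {1}alphaE mulrA valley_dynkin -scalerAl -alphaE.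
  rewrite -signr_odd /=; case: (odd n) => /=.
    by rewrite expr1 subrr scale0r.
  by rewrite expr0.
split=> // n_odd; rewrite n_odd in Xi_alpha.
have nz2 : 2%:R != 0 :> K by move/pcharf0P: charK => ->.
rewrite /tilde; set beta := _ *: _.
(* Since [beta] is also a right multiple of [alpha], this gives both idempotence and equality of the
   right ideals. *)
have beta_alpha : beta * alpha = alpha.
  by rewrite /beta -scalerAl -mulrA Xi_alpha -scalerAr alpha_idem scalerA mulVf ?scale1r.
have alpha_beta : beta = alpha * (2%:R^-1 *: Xi_tilde K n.+1) by rewrite -scalerAr.
split; last first.
  by rewrite rpredZ // Xi_tilde_valley descent_valley_peak.
split; first by rewrite {2}alpha_beta mulrA beta_alpha -alpha_beta.
move=> x; split => [[z ->]|/alpha_dyn[z ->]].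
  by apply/alpha_dyn; rewrite alpha_beta -mulrA; eexists.
by exists (alpha * z); rewrite mulrA beta_alpha.
Qed.
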